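(* Let $b\ge2$, $s\ge1$, and $0\le u\le m$ be integers and let $\boldsymbol{e}=(e_1,\ldots,e_s)\in\mathbb{N}^s$ be an $s$-tuple of positive integers. Then any $(u,m,\boldsymbol{e},s)$-net in base $b$ is a $(t,m,s)$-net in base $b$ with $$t=\min\Big(u+\sum_{i=1}^s(e_i-1),\,m\Big).$$
   Context: Point sets are counted with multiplicity: for a point set $\mathcal{P}$ (finite indexed family), $A(J;\mathcal{P})$ is the number of indices $n$ with $\boldsymbol{x}_n\in J$. A *$(u,m,\boldsymbol{e},s)$-net in base $b$* is a point set $\mathcal{P}$ of $b^m$ points in $[0,1)^s$ such that $A(J;\mathcal{P})=b^m\,\mathrm{Vol}(J)$ for every interval $J=\prod_{i=1}^s[a_ib^{-d_i},(a_i+1)b^{-d_i})$ with integers $d_i\ge0$, $0\le a_i<b^{d_i}$, $e_i\mid d_i$ for $1\le i\le s$, and $\mathrm{Vol}(J)\ge b^{u-m}$. For integers $0\le t\le m$, a *$(t,m,s)$-net in base $b$* is a point set of $b^m$ points in $[0,1)^s$ such that every interval $\prod_{i=1}^s[a_ib^{-d_i},(a_i+1)b^{-d_i})$ with integers $d_i\ge0$, $0\le a_i<b^{d_i}$ and volume $b^{t-m}$ contains exactly $b^t$ of the points. *)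

(* Defs.v *)
From mathcomp Require Export all_boot all_order all_algebra.
From mathcomp Require Export reals.

Set Implicit Arguments.
Unset Strict Implicit.
Unset Printing Implicit Defensive.

Import Order.TTheory GRing.Theory Num.Theory.
Local Open Scope ring_scope.

(* The half-open box prod_i [lower_i, upper_i). *)
Record box (R : realType) (s : nat) := Box {
  lower : 'rV[R]_s;
  upper : 'rV[R]_s
}.

Definition in_box (R : realType) (s : nat) (J : box R s) (x : 'rV[R]_s) : bool :=
  [forall i : 'I_s, x 0 i \in `[lower J 0 i, upper J 0 i[].

(* Agrees with the Lebesgue measure of the box when lower <= upper. *)
Definition vol (R : realType) (s : nat) (J : box R s) : R :=
  \prod_(i < s) (upper J 0 i - lower J 0 i).

Definition unit_box (R : realType) (s : nat) : box R s :=
  Box (const_mx 0) (const_mx 1).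

Definition elementary_box (R : realType) (s b : nat) (d a : 'I_s -> nat) : box R s :=
  Box (\row_(i < s) ((a i)%:R / b%:R ^+ d i))
      (\row_(i < s) ((a i).+1%:R / b%:R ^+ d i)).

(* A point set is an indexed family P : 'I_N -> 'rV[R]_s, so that repeated
   points are counted with multiplicity. *)
Definition count_in (R : realType) (s N : nat) (J : box R s)
    (P : 'I_N -> 'rV[R]_s) : nat :=
  #|[set n : 'I_N | in_box J (P n)]|.

(* The exponents u - m and t - m below are (possibly negative) integers. *)
Definition umes_net (R : realType) (b u m s : nat) (e : 'I_s -> nat)
    (N : nat) (P : 'I_N -> 'rV[R]_s) : Prop :=
  [/\ N = (b ^ m)%N,
      forall n : 'I_N, in_box (unit_box R s) (P n)
    & forall d a : 'I_s -> nat,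
        (forall i, a i < b ^ d i)%N ->
        (forall i, e i %| d i)%N ->
        b%:R ^ (u%:Z - m%:Z) <= vol (elementary_box R b d a) ->
        (count_in (elementary_box R b d a) P)%:R
          = b%:R ^+ m * vol (elementary_box R b d a)].

Definition tms_net (R : realType) (b t m s : nat)
    (N : nat) (P : 'I_N -> 'rV[R]_s) : Prop :=
  [/\ (t <= m)%N,
      N = (b ^ m)%N,
      forall n : 'I_N, in_box (unit_box R s) (P n)
    & forall d a : 'I_s -> nat,
        (forall i, a i < b ^ d i)%N ->
        vol (elementary_box R b d a) = b%:R ^ (t%:Z - m%:Z) ->
        count_in (elementary_box R b d a) P = (b ^ t)%N].

(* Main.v *)
(** Rounding each resolution [d_i] up to the next multiple of [e_i] costs at
    most [e_i - 1], so an interval of volume [b^(t-m)] splits into disjoint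
    intervals with [e_i %| d_i] of volume at least [b^(u-m)], on which the
    counting hypothesis applies.  The splitting is done one base-[b] digit at a
    time, by induction on the total number of missing digits.  In the truncated
    case [t = m] all [d_i] vanish and no rounding occurs. *)
Require Import Defs.
From mathcomp Require Import all_boot all_order all_algebra.
From mathcomp Require Import reals.

Set Implicit Arguments.
Unset Strict Implicit.
Unset Printing Implicit Defensive.

Import Order.TTheory GRing.Theory Num.Theory.
Local Open Scope ring_scope.

Lemma sum_unit_intervals (R : realDomainType) (y : R) (q k : nat) :
  (\sum_(r < k) (y \in `[(q + r)%:R, (q + r).+1%:R[) : nat)%N
    = (y \in `[q%:R, (q + k)%:R[).
Proof.
elim: k => [|k IH]; first by rewrite big_ord0 addn0 in_itv /= leNgt andNb.
rewrite big_ord_recr /= IH addnS !in_itv /=.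
have qk : q%:R <= (q + k)%:R :> R by rewrite ler_nat leq_addr.
have kS : (q + k)%:R <= (q + k).+1%:R :> R by rewrite ler_nat.
case: (ltP y (q + k)%:R) => [yk|ky].
  by rewrite (lt_le_trans yk kS) !andbT addn0.
by rewrite (le_trans qk ky) /= add0n.
Qed.

(** Scaling by [b ^ d.+1] turns the [b] pieces into consecutive unit intervals running from [a * b]
    to [a.+1 * b]. *)
Lemma sum_digit_intervals (R : realFieldType) (x : R) (b a d : nat) :
  (0 < b)%N ->
  (\sum_(r < b) (x \in `[(a * b + r)%:R / b%:R ^+ d.+1,
                         (a * b + r).+1%:R / b%:R ^+ d.+1[) : nat)%N
    = (x \in `[a%:R / b%:R ^+ d, a.+1%:R / b%:R ^+ d[).
Proof.
move=> b0; have b0R : 0 < b%:R :> R by rewrite ltr0n.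
transitivity ((x * b%:R ^+ d.+1 \in `[(a * b)%:R, (a * b + b)%:R[) : nat).
  rewrite -sum_unit_intervals; apply: eq_bigr => r _.
  by rewrite !in_itv /= ler_pdivrMr ?exprn_gt0 // ltr_pdivlMr ?exprn_gt0.
rewrite -mulSnr !in_itv /= exprSr mulrA !natrM ler_pM2r // ltr_pM2r //.
by rewrite ler_pdivrMr ?exprn_gt0 // ltr_pdivlMr ?exprn_gt0.
Qed.

(** The indicator of a box is a product over coordinates, and refining coordinate [i] changes only
    one factor. Writing counts as sums of indicators and exchanging sums reduces the claim to
    dimension one. *)
Lemma count_in_split_digit (R : realType) (b s N : nat) (P : 'I_N -> 'rV[R]_s)
    (d a : 'I_s -> nat) (i : 'I_s) :
  (0 < b)%N ->
  count_in (elementary_box R b d a) P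
    = (\sum_(r < b) count_in (elementary_box R b [eta d with i |-> (d i).+1]
                                [eta a with i |-> (a i * b + r)%N]) P)%N.
Proof.
move=> b0.
have countE (J : box R s) : count_in J P = (\sum_n (in_box J (P n) : nat))%N.
  by rewrite /count_in -sum1dep_card big_mkcond; apply: eq_bigr => n _; case: in_box.
rewrite countE; under [RHS]eq_bigr do rewrite countE.
rewrite exchange_big; apply: eq_bigr => n _ /=.
have in_boxE (J : box R s) x : (in_box J x : nat)
    = ((x 0%R i \in `[lower J 0%R i, upper J 0%R i[)
       * \prod_(j | j != i) (x 0%R j \in `[lower J 0%R j, upper J 0%R j[))%N.
  have -> : (in_box J x : nat)
      = (\prod_j (x 0%R j \in `[lower J 0%R j, upper J 0%R j[) : nat)%N.
    have -> : in_box J x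
        = \big[andb/true]_j (x 0%R j \in `[lower J 0%R j, upper J 0%R j[).
      by rewrite big_andE.
    by apply: (big_morph nat_of_bool) => // p q; rewrite mulnb.
  by rewrite (bigD1 i).
rewrite in_boxE /= !mxE -sum_digit_intervals // big_distrl /=.
apply: eq_bigr => r _; rewrite in_boxE /= !mxE /= eqxx; congr muln.
by apply: eq_bigr => j /negPf ji; rewrite !mxE /= ji.
Qed.

Lemma vol_elementary_box (R : realType) (b s : nat) (d a : 'I_s -> nat) :
  vol (elementary_box R b d a) = (b%:R ^+ (\sum_i d i)%N)^-1.
Proof.
rewrite -prodrXr -prodfV; apply: eq_bigr => i _.
by rewrite !mxE -mulrBl -natrB // subSnn mul1r.
Qed.

(** Equidistribution at resolution [d'] passes to every coarser [d], by induction on the number of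
    missing digits. The premise is stated up to [=1] because the induction reaches [d'] only
    pointwise. *)
Lemma count_in_coarsen (R : realType) (b s m N : nat) (P : 'I_N -> 'rV[R]_s)
    (d' : 'I_s -> nat) :
  (0 < b)%N -> (\sum_i d' i <= m)%N ->
  (forall d a, d =1 d' -> (forall i, a i < b ^ d i)%N ->
     count_in (elementary_box R b d a) P = b ^ (m - \sum_i d i))%N ->
  forall d a, (forall i, d i <= d' i)%N -> (forall i, a i < b ^ d i)%N ->
     count_in (elementary_box R b d a) P = (b ^ (m - \sum_i d i))%N.
Proof.
move=> b0 d'm fine d a dd'.
have [k] := ubnP (\sum_i (d' i - d i))%N.
elim: k d a dd' => // k IH d a dd'; rewrite ltnS => dk ad.
have [/forallP eqd|] := boolP [forall i, d i == d' i].
  by apply: fine => // i; apply/eqP.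
rewrite negb_forall => /existsP[i di].
have lti : (d i < d' i)%N by rewrite ltn_neqAle di dd'.
have sumS : (\sum_j [eta d with i |-> (d i).+1] j = (\sum_j d j).+1)%N.
  rewrite (bigD1 i) //= eqxx [in RHS](bigD1 i) //= addSn; congr (_ + _).+1.
  by apply: eq_bigr => j /negPf ->.
have dd'S j : ([eta d with i |-> (d i).+1] j <= d' j)%N.
  by rewrite /=; case: eqP => [->|].
(* Strictness keeps the subtraction from truncating, so that [b * b ^ (m - S.+1) = b ^ (m - S)] for
   [S = \sum_j d j]. *)
have ltm : (\sum_j d j < m)%N.
  by rewrite -sumS; apply: leq_trans d'm; apply: leq_sum.
rewrite (count_in_split_digit P d a i b0).
transitivity (\sum_(r < b) b ^ (m - (\sum_j d j).+1))%N.
  apply: eq_bigr => r _; rewrite IH ?sumS //.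
    apply: leq_trans dk; rewrite [X in (_ < X)%N](bigD1 i) //= (bigD1 i) //= eqxx.
    rewrite -addSn leq_add //; first by rewrite -subSn // subSS.
    by apply: leq_sum => j /negPf ->.
  move=> j /=; case: eqP => // _.
  (* The refined index stays in range: [a i * b + r < (a i).+1 * b <= b ^ (d i).+1]. *)
  apply: (@leq_trans ((a i).+1 * b)); first by rewrite mulSnr ltn_add2l.
  by rewrite expnSr leq_mul2r ad orbT.
by rewrite sum_nat_const card_ord -expnS -subSn // subSS.
Qed.

(** The net property in natural-number form: the volume is [b ^ (- \sum_i d i)], so the lower bound
    on it becomes an upper bound on the sum of resolutions. *)
Lemma umes_net_count (R : realType) (b u m s N : nat) (e : 'I_s -> nat)
    (P : 'I_N -> 'rV[R]_s) (d a : 'I_s -> nat) :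
  (0 < b)%N -> (u <= m)%N -> umes_net b u m e P ->
  (forall i, a i < b ^ d i)%N -> (forall i, e i %| d i)%N ->
  (\sum_i d i <= m - u)%N ->
  count_in (elementary_box R b d a) P = (b ^ (m - \sum_i d i))%N.
Proof.
move=> b0 um [_ _ net] ad ed dmu.
have dm : (\sum_i d i <= m)%N := leq_trans dmu (leq_subr _ _).
have bU : b%:R \is a @GRing.unit R by rewrite unitfE pnatr_eq0 -lt0n.
apply/eqP; rewrite -(eqr_nat R) net //.
  by rewrite vol_elementary_box natrX exprB.
rewrite vol_elementary_box -[u%:Z - _]opprB subzn // -exprnN.
by rewrite lef_pV2 ?posrE ?exprn_gt0 ?ltr0n // ler_weXn2l // ler1n.
Qed.

Theorem proposition1 (R : realType) (b s u m : nat) (e : 'I_s -> nat)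
    (hb : (2 <= b)%N) (hs : (1 <= s)%N) (hum : (u <= m)%N)
    (he : forall i : 'I_s, (0 < e i)%N)
    (N : nat) (P : 'I_N -> 'rV[R]_s) :
  umes_net b u m e P ->
  tms_net b (minn (u + \sum_(i < s) (e i - 1)) m)%N m P.
Proof.
move=> net; have [NE P01 _] := net.
have b0 : (0 < b)%N := ltnW hb.
set t := minn _ m; have tm : (t <= m)%N by apply: geq_minr.
split=> // d a ad volE.
have sumd : (\sum_i d i = m - t)%N.
  move: volE; rewrite vol_elementary_box -[t%:Z - _]opprB subzn // -exprnN.
  move/invr_inj/eqP; rewrite -!natrX eqr_nat => /eqP.
  exact: expnI.
(* The least multiple of [e i] that is at least [d i]. *)
pose d' i := ((d i + (e i - 1)) %/ e i * e i)%N.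
have d'le i : (d' i <= d i + (e i - 1))%N by apply: leq_divM.
have dd' i : (d i <= d' i)%N.
  have := ltn_ceil (d i + (e i - 1)) (he i).
  by rewrite mulSnr -/(d' i) -{2}(subnK (he i)) addnA addn1 ltnS leq_add2r.
have sumd' : (\sum_i d' i <= m - u)%N.
  have [tle|mlt] := leqP (u + \sum_(i < s) (e i - 1)) m.
    have tE : t = (u + \sum_(i < s) (e i - 1))%N by apply/minn_idPl.
    (* Without truncation the bound is exact: [m - t] plus the total rounding cost equals
       [m - u]. *)
    apply: (leq_trans (leq_sum _ (fun i _ => d'le i))).
    by rewrite big_split /= sumd tE subnDA subnK // leq_subRL.
  have tE : t = m by apply/minn_idPr/ltnW.
  rewrite big1 // => i _.
  have /eqP : (\sum_i d i = 0)%N by rewrite sumd tE subnn.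
  rewrite sum_nat_eq0 => /forallP /(_ i) /eqP d0.
  (* With [d i = 0] the quotient is [(e i - 1) %/ e i = 0]. *)
  by rewrite /d' d0 add0n divn_small // subn1 ltn_predL.
have -> : (b ^ t = b ^ (m - \sum_i d i))%N by rewrite sumd subKn.
apply: (count_in_coarsen b0 (leq_trans sumd' (leq_subr _ _)) _ dd' ad).
move=> d1 a1 d1E ad1; apply: (umes_net_count b0 hum net ad1).
  by move=> i; rewrite d1E dvdn_mull.
by rewrite (eq_bigr _ (fun i _ => d1E i)).
Qed.
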